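(* $$\int_0^\infty \frac{\cos ax-\cos bx}{\sinh\beta x}\,\frac{dx}{x}=\ln\cosh\frac{b\pi}{2\beta}-\ln\cosh\frac{a\pi}{2\beta}.$$ *)

(* Defs.v *)
From Stdlib Require Export Reals.
From Coquelicot Require Export Coquelicot.

(* Main.v *)
Require Import Defs.
From Stdlib Require Import Reals Lra Lia.
From Coquelicot Require Import Coquelicot.

Open Scope R_scope.

(** Expand [1 / sinh (beta x)] as [2 sum_{k < n} exp (- (2 k + 1) beta x)] plus the remainder
    [exp (- 2 n beta x) / sinh (beta x)], whose contribution to the integral is [O(1/n)].  With
    [c = (2 k + 1) beta], the [k]-th term contributes the Frullani value
    [ln (c^2 + b^2) - ln (c^2 + a^2)], so what remains is the logarithm of the product
    [cosh (PI b / 2) = prod_k (1 + b^2 / (2 k + 1)^2)].  This product is obtained from the integrals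
    [J_n(b) = int_0^{PI/2} cosh (b t) cos^n t dt]: two integrations by parts give
    [(n^2 + b^2) J_n = n (n - 1) J_{n-2}], and [J_n(b) / J_n(0) -> 1] because [cos^n] concentrates
    at [0]. *)

(** * Elementary bounds on hyperbolic and trigonometric functions *)

Lemma exp_monotone (x y : R) : x <= y -> exp x <= exp y.
Proof.
intros [H| ->]; [left; apply exp_increasing, H|apply Rle_refl].
Qed.

Lemma cosh_ge_1 (u : R) : 1 <= cosh u.
Proof.
unfold cosh; rewrite exp_Ropp.
assert (H := exp_pos u).
apply (Rmult_le_reg_r (2 * exp u)); [lra|].
replace ((exp u + / exp u) / 2 * (2 * exp u)) with (exp u * exp u + 1) by (field; lra).
assert (H1 := pow2_ge_0 (exp u - 1)); lra.
Qed.

Lemma cosh_le_exp (u B : R) : Rabs u <= B -> cosh u <= exp B.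
Proof.
intros H; apply Rabs_le_between in H; unfold cosh.
assert (H1 : exp u <= exp B) by (apply exp_monotone; lra).
assert (H2 : exp (- u) <= exp B) by (apply exp_monotone; lra).
lra.
Qed.

Lemma is_derive_cosh (u : R) : is_derive cosh u (sinh u).
Proof. apply is_derive_Reals, derivable_pt_lim_cosh. Qed.

Lemma is_derive_sinh (u : R) : is_derive sinh u (cosh u).
Proof. apply is_derive_Reals, derivable_pt_lim_sinh. Qed.

(** The two conditions on [c] place it between [0] and [u] whatever the sign of [u], in a form
    suited to [nra]. *)
Lemma mvt_from_0 (f df : R -> R) (u : R) :
  (forall x, is_derive f x (df x)) ->
  exists c, 0 <= c * u /\ Rabs c <= Rabs u /\ f u - f 0 = df c * u.
Proof.
intros Hf.
destruct (MVT_gen f 0 u df) as [c [Hc E]].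
- intros x _; apply Hf.
- intros x _; apply derivable_continuous_pt; exists (df x); apply is_derive_Reals, Hf.
- exists c; rewrite Rminus_0_r in E; revert Hc.
  unfold Rmin, Rmax; destruct (Rle_dec 0 u) as [Hu|Hu]; intros Hc;
    (split; [nra|split; [|exact E]]).
  + rewrite !Rabs_right; lra.
  + rewrite !Rabs_left1; lra.
Qed.

(** Two uses of the mean value theorem give [cosh u - 1 = cosh d * c * u] with
    [Rabs d <= Rabs c <= Rabs u]. *)
Lemma cosh_sub_1_le (u B : R) : Rabs u <= B -> cosh u - 1 <= exp B * u ^ 2.
Proof.
intros HB.
destruct (mvt_from_0 cosh sinh u is_derive_cosh) as [c [Hc [Hcu Ec]]].
destruct (mvt_from_0 sinh cosh c is_derive_sinh) as [d [_ [Hdc Ed]]].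
rewrite cosh_0 in Ec; rewrite sinh_0 in Ed.
rewrite Ec; replace (sinh c) with (cosh d * c) by lra.
assert (Hd : cosh d <= exp B) by (apply cosh_le_exp; lra).
assert (Hd1 := cosh_ge_1 d).
assert (Hcu2 : c * u <= u ^ 2).
{ rewrite <- (Rabs_right (c * u)) by lra.
  rewrite <- (pow2_abs u), Rabs_mult.
  assert (H := Rabs_pos u); nra. }
nra.
Qed.

(** This is [t <= tan t] without division: [sin t = t * cos c] for some [c] between [0] and [t], and
    [cos] decreases there. *)
Lemma mul_cos_le_sin (t : R) : 0 <= t <= PI / 2 -> t * cos t <= sin t.
Proof.
intros Ht; assert (HP := PI_RGT_0).
destruct (mvt_from_0 sin cos t) as [c [Hc [Hct E]]].
{ intros x; apply is_derive_Reals, derivable_pt_lim_sin. }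
rewrite sin_0 in E.
destruct (Req_dec t 0) as [->|Ht0]; [rewrite sin_0; lra|].
assert (0 <= c) by nra.
rewrite !Rabs_right in Hct by lra.
assert (cos t <= cos c) by (apply cos_decr_1; lra).
nra.
Qed.

(* [ex_derive_continuous] at codomain [R]: its module argument does not unify when applied directly. *)
Lemma continuous_derivable (f : R -> R) (x : R) : ex_derive f x -> continuous f x.
Proof. exact (ex_derive_continuous f x). Qed.

(** * Wallis integrals weighted by [cosh], and their recurrence *)

Definition wallis_cosh (b : R) (n : nat) : R :=
  RInt (fun t => cosh (b * t) * cos t ^ n) 0 (PI / 2).

Lemma ex_RInt_wallis_cosh (b : R) (n : nat) :
  ex_RInt (fun t => cosh (b * t) * cos t ^ n) 0 (PI / 2).
Proof.
apply (ex_RInt_continuous (V := R_CompleteNormedModule)); intros t _.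
apply continuous_derivable; auto_derive; trivial.
Qed.

Lemma wallis_cosh_1 (b : R) : (1 + b ^ 2) * wallis_cosh b 1 = cosh (b * (PI / 2)).
Proof.
unfold wallis_cosh.
rewrite <- (RInt_scal (V := R_CompleteNormedModule)) by apply ex_RInt_wallis_cosh.
apply (is_RInt_unique (V := R_CompleteNormedModule)).
(* An antiderivative of [(1 + b^2) * cosh (b * t) * cos t]: the terms in [sinh (b * t) * sin t]
   cancel. *)
set (W := fun t => cosh (b * t) * sin t + b * sinh (b * t) * cos t).
replace (cosh (b * (PI / 2))) with (minus (W (PI / 2)) (W 0)).
- apply (is_RInt_derive (V := R_CompleteNormedModule)); intros t _.
  + unfold W; auto_derive; trivial; unfold scal; simpl; unfold mult; simpl; ring.
  + apply continuous_derivable; unfold scal; simpl; unfold mult; simpl; auto_derive; trivial.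
- unfold W, minus, plus, opp; simpl.
  rewrite sin_PI2, cos_PI2, sin_0, cos_0, (Rmult_0_r b), sinh_0; ring.
Qed.

Lemma wallis_cosh_SS (b : R) (n : nat) :
  (INR (n + 2) ^ 2 + b ^ 2) * wallis_cosh b (n + 2) =
  INR (n + 2) * INR (n + 1) * wallis_cosh b n.
Proof.
enough (H : is_RInt
   (fun t => (INR (n + 2) ^ 2 + b ^ 2) * (cosh (b * t) * cos t ^ (n + 2)) -
             INR (n + 2) * INR (n + 1) * (cosh (b * t) * cos t ^ n)) 0 (PI / 2) 0).
{ apply (is_RInt_unique (V := R_CompleteNormedModule)) in H.
  rewrite (RInt_minus (V := R_CompleteNormedModule)
             (fun t => (INR (n + 2) ^ 2 + b ^ 2) * (cosh (b * t) * cos t ^ (n + 2)))) in H;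
    try (apply (ex_RInt_scal (V := R_CompleteNormedModule)); apply ex_RInt_wallis_cosh).
  rewrite !(RInt_scal (V := R_CompleteNormedModule)) in H by apply ex_RInt_wallis_cosh.
  apply Rminus_diag_uniq, H. }
(* Both integrations by parts packed into one antiderivative. It vanishes at [0] through [sinh] and
   [sin], and at [PI / 2] through the powers of [cos], whose exponents are positive. *)
set (W := fun t => b * sinh (b * t) * cos t ^ (n + 2)
                   + INR (n + 2) * cosh (b * t) * cos t ^ (n + 1) * sin t).
replace 0 with (minus (W (PI / 2)) (W 0)) at 2.
- apply (is_RInt_derive (V := R_CompleteNormedModule)); intros t _.
  + unfold W; auto_derive; trivial.
    replace (Init.Nat.pred (n + 2)) with (n + 1)%nat by lia.
    replace (Init.Nat.pred (n + 1)) with n by lia.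
    rewrite !pow_add, !plus_INR; simpl.
    assert (E : sin t * sin t = 1 - cos t * cos t).
    { assert (H := sin2_cos2 t); unfold Rsqr in H; lra. }
    ring_simplify; replace (sin t ^ 2) with (1 - cos t ^ 2) by (simpl; lra); ring.
  + apply continuous_derivable; auto_derive; trivial.
- unfold W, minus, plus, opp; simpl.
  rewrite sin_PI2, cos_PI2, sin_0, (Rmult_0_r b), sinh_0, !pow_ne_zero by lia; ring.
Qed.

(** Positivity climbs the recurrence from [wallis_cosh_1]; it is what allows logarithms to be taken
    below. *)
Lemma wallis_cosh_odd_pos (b : R) (m : nat) : 0 < wallis_cosh b (2 * m + 1).
Proof.
induction m as [|m IH].
- simpl Nat.add; assert (H := wallis_cosh_1 b); assert (H1 := cosh_ge_1 (b * (PI / 2))).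
  assert (0 <= b ^ 2) by apply pow2_ge_0; nra.
- replace (2 * S m + 1)%nat with (2 * m + 1 + 2)%nat by lia.
  assert (H := wallis_cosh_SS b (2 * m + 1)).
  assert (H1 : 0 < INR (2 * m + 1 + 2)) by (apply lt_0_INR; lia).
  assert (H2 : 0 < INR (2 * m + 1 + 1)) by (apply lt_0_INR; lia).
  assert (H3 : 0 <= b ^ 2) by apply pow2_ge_0.
  apply (Rmult_lt_reg_l (INR (2 * m + 1 + 2) ^ 2 + b ^ 2)); [nra|].
  rewrite H, Rmult_0_r; repeat apply Rmult_lt_0_compat; assumption.
Qed.

Lemma wallis_cosh_ge (b : R) (n : nat) : wallis_cosh 0 n <= wallis_cosh b n.
Proof.
assert (HP := PI_RGT_0).
apply RInt_le; try apply ex_RInt_wallis_cosh; [lra|]; intros t Ht.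
rewrite Rmult_0_l, cosh_0.
apply Rmult_le_compat_r; [|apply cosh_ge_1].
apply pow_le, cos_ge_0; lra.
Qed.

(* [1 - cos^2 = sin^2 >= t^2 cos^2] lets the recurrence absorb the factor [cosh (b t) - 1 = O(t^2)]. *)
Lemma wallis_cosh_le (b : R) (n : nat) :
  wallis_cosh b (n + 2) <=
  wallis_cosh 0 (n + 2)
  + exp (Rabs b * (PI / 2)) * b ^ 2 * (wallis_cosh 0 n - wallis_cosh 0 (n + 2)).
Proof.
assert (HP := PI_RGT_0).
set (K := exp (Rabs b * (PI / 2)) * b ^ 2).
set (F := fun t => cosh (0 * t) * cos t ^ (n + 2)
   + K * (cosh (0 * t) * cos t ^ n - cosh (0 * t) * cos t ^ (n + 2))).
assert (HF : is_RInt F 0 (PI / 2) (wallis_cosh 0 (n + 2)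
   + K * (wallis_cosh 0 n - wallis_cosh 0 (n + 2)))).
{ apply (is_RInt_plus (V := R_NormedModule));
    [|apply (is_RInt_scal (V := R_NormedModule)), (is_RInt_minus (V := R_NormedModule))];
    apply (RInt_correct (V := R_CompleteNormedModule)), ex_RInt_wallis_cosh. }
rewrite <- (is_RInt_unique (V := R_CompleteNormedModule) _ _ _ _ HF).
apply RInt_le; [lra|apply ex_RInt_wallis_cosh|eexists; exact HF|].
intros t Ht; unfold F; rewrite Rmult_0_l, cosh_0, !pow_add, !Rmult_1_l.
assert (Hc : 0 <= cos t) by (apply cos_ge_0; lra).
assert (Hcn : 0 <= cos t ^ n) by (apply pow_le, Hc).
assert (Hs : t * cos t <= sin t) by (apply mul_cos_le_sin; lra).
assert (H1 : cosh (b * t) - 1 <= exp (Rabs b * (PI / 2)) * (b * t) ^ 2).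
{ apply cosh_sub_1_le; rewrite Rabs_mult, (Rabs_right t) by lra.
  apply Rmult_le_compat_l; [apply Rabs_pos|lra]. }
assert (H2 : (t * cos t) ^ 2 <= 1 - cos t ^ 2).
{ replace (1 - cos t ^ 2) with (sin t ^ 2)
    by (generalize (sin2_cos2 t); unfold Rsqr; simpl; lra).
  apply pow_incr; split; [nra|exact Hs]. }
assert (HK : 0 <= K).
{ apply Rmult_le_pos; [left; apply exp_pos|apply pow2_ge_0]. }
assert (H3 : (cosh (b * t) - 1) * cos t ^ 2 <= K * (1 - cos t ^ 2)).
{ apply Rle_trans with (K * (t * cos t) ^ 2); [|apply Rmult_le_compat_l; assumption].
  replace (K * (t * cos t) ^ 2) with (exp (Rabs b * (PI / 2)) * (b * t) ^ 2 * cos t ^ 2)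
    by (unfold K; ring).
  apply Rmult_le_compat_r; [apply pow2_ge_0|exact H1]. }
nra.
Qed.

(** * Logarithm of the product for [cosh], with an error bound *)

Lemma ln_wallis_cosh_ratio_ge_0 (b : R) (m : nat) :
  0 <= ln (wallis_cosh b (2 * m + 1)) - ln (wallis_cosh 0 (2 * m + 1)).
Proof.
assert (H := wallis_cosh_odd_pos 0 m).
assert (H1 := ln_le _ _ H (wallis_cosh_ge b (2 * m + 1))); lra.
Qed.

(** The recurrence at [b = 0] makes the difference of consecutive odd integrals a [1 / (2 N)]
    fraction of the later one, so the ratio is at most [1 + K / N <= exp (K / N)]. *)
Lemma ln_wallis_cosh_ratio_le (b : R) (m : nat) :
  ln (wallis_cosh b (2 * S m + 1)) - ln (wallis_cosh 0 (2 * S m + 1)) <=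
  exp (Rabs b * (PI / 2)) * b ^ 2 / INR (S m).
Proof.
assert (Hb := wallis_cosh_odd_pos b (S m)).
assert (H0 := wallis_cosh_odd_pos 0 (S m)).
assert (Hle := wallis_cosh_le b (2 * m + 1)).
assert (Hrec := wallis_cosh_SS 0 (2 * m + 1)).
replace (2 * m + 1 + 2)%nat with (2 * S m + 1)%nat in * by lia.
replace (2 * m + 1 + 1)%nat with (2 * S m)%nat in * by lia.
set (B := wallis_cosh b (2 * S m + 1)) in *.
set (Z := wallis_cosh 0 (2 * S m + 1)) in *.
set (Y := wallis_cosh 0 (2 * m + 1)) in *.
set (K := exp (Rabs b * (PI / 2)) * b ^ 2) in *.
assert (HK : 0 <= K).
{ apply Rmult_le_pos; [left; apply exp_pos|apply pow2_ge_0]. }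
rewrite plus_INR, mult_INR in Hrec.
assert (HN : 0 < INR (S m)) by (apply lt_0_INR; lia).
set (N := INR (S m)) in *; simpl INR in Hrec.
rewrite <- ln_div by assumption.
assert (HY : Y - Z = Z / (2 * N)).
{ apply (Rmult_eq_reg_l ((2 * N + 1) * (2 * N))); [|nra].
  apply (Rmult_eq_reg_l 1); [|lra].
  field_simplify; [|lra]; field_simplify in Hrec; lra. }
assert (HBZ : B / Z <= 1 + K / N).
{ apply (Rmult_le_reg_r Z); [assumption|].
  replace (B / Z * Z) with B by (field; lra).
  apply Rle_trans with (1 := Hle); rewrite HY.
  replace ((1 + K / N) * Z) with (Z + K * (Z / (2 * N)) * 2) by (field; lra).
  assert (0 <= K * (Z / (2 * N)));
    [apply Rmult_le_pos; [exact HK|apply Rdiv_le_0_compat; lra]|lra]. }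
apply Rle_trans with (ln (exp (K / N))); [|rewrite ln_exp; lra].
apply ln_le; [apply Rdiv_lt_0_compat; assumption|].
apply Rle_trans with (1 := HBZ), exp_ineq1_le.
Qed.

(** Logarithm of the partial product, without dividing by [(2 k + 1)^2]: only differences between
    two values of [b] matter, and there the normalisation cancels. *)
Fixpoint sum_ln_odd (b : R) (n : nat) : R :=
  match n with
  | O => 0
  | S m => sum_ln_odd b m + ln (INR (2 * m + 1) ^ 2 + b ^ 2)
  end.

(** Exact finite form of the product: by induction the left side does not depend on [b]. At [m = 0]
    both sides vanish by [wallis_cosh_1]. *)
Lemma sum_ln_odd_wallis (b : R) (m : nat) :
  sum_ln_odd b (S m) + ln (wallis_cosh b (2 * m + 1)) - ln (cosh (b * (PI / 2))) =
  sum_ln_odd 0 (S m) + ln (wallis_cosh 0 (2 * m + 1)) - ln (cosh (0 * (PI / 2))).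
Proof.
assert (Hsq : forall x, 0 <= x ^ 2) by (intros; apply pow2_ge_0).
induction m as [|m IH].
- simpl sum_ln_odd; simpl Nat.add; rewrite <- !wallis_cosh_1.
  assert (Hb := wallis_cosh_odd_pos b 0); assert (H0 := wallis_cosh_odd_pos 0 0).
  specialize (Hsq b); simpl Nat.add in *.
  rewrite !ln_mult by (simpl in *; lra).
  simpl; rewrite !Rmult_1_r; lra.
(* Logarithm of the recurrence: the increment [ln (INR (2 * S m + 1) * INR (2 * S m))] is free of
   [c], hence the same for [b] and [0]. *)
- assert (Hstep : forall c,
    ln (wallis_cosh c (2 * S m + 1)) + ln (INR (2 * S m + 1) ^ 2 + c ^ 2) =
    ln (INR (2 * S m + 1) * INR (2 * S m)) + ln (wallis_cosh c (2 * m + 1))).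
  { intros c; assert (Hrec := wallis_cosh_SS c (2 * m + 1)).
    replace (2 * m + 1 + 2)%nat with (2 * S m + 1)%nat in * by lia.
    replace (2 * m + 1 + 1)%nat with (2 * S m)%nat in * by lia.
    assert (0 < INR (2 * S m + 1)) by (apply lt_0_INR; lia).
    assert (0 < INR (2 * S m)) by (apply lt_0_INR; lia).
    specialize (Hsq c).
    rewrite <- !ln_mult; try apply wallis_cosh_odd_pos; try nra.
    f_equal; lra. }
  assert (Hb := Hstep b); assert (H0 := Hstep 0).
  change (sum_ln_odd b (S (S m)))
    with (sum_ln_odd b (S m) + ln (INR (2 * S m + 1) ^ 2 + b ^ 2)).
  change (sum_ln_odd 0 (S (S m)))
    with (sum_ln_odd 0 (S m) + ln (INR (2 * S m + 1) ^ 2 + 0 ^ 2)).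
  lra.
Qed.

(** Subtracting the exact identities for [a] and [b] leaves two logarithmic ratios, each between [0]
    and a constant over [INR (S m)]. *)
Lemma sum_ln_odd_approx (a b : R) : exists K, 0 <= K /\ forall m,
  Rabs (sum_ln_odd b (S (S m)) - sum_ln_odd a (S (S m))
        - (ln (cosh (b * (PI / 2))) - ln (cosh (a * (PI / 2))))) <= K / INR (S m).
Proof.
set (A := exp (Rabs a * (PI / 2)) * a ^ 2); set (B := exp (Rabs b * (PI / 2)) * b ^ 2).
assert (HA : 0 <= A).
{ apply Rmult_le_pos; [left; apply exp_pos|apply pow2_ge_0]. }
assert (HB : 0 <= B).
{ apply Rmult_le_pos; [left; apply exp_pos|apply pow2_ge_0]. }
exists (A + B); split; [lra|]; intros m.
assert (HN : 0 < INR (S m)) by (apply lt_0_INR; lia).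
assert (HA' : 0 <= A / INR (S m)) by (apply Rdiv_le_0_compat; assumption).
assert (HB' : 0 <= B / INR (S m)) by (apply Rdiv_le_0_compat; assumption).
assert (Ha := sum_ln_odd_wallis a (S m)); assert (Hb := sum_ln_odd_wallis b (S m)).
assert (Ha1 := ln_wallis_cosh_ratio_ge_0 a (S m)).
assert (Hb1 := ln_wallis_cosh_ratio_ge_0 b (S m)).
assert (Ha2 := ln_wallis_cosh_ratio_le a m); assert (Hb2 := ln_wallis_cosh_ratio_le b m).
fold A in Ha2; fold B in Hb2.
replace ((A + B) / INR (S m)) with (A / INR (S m) + B / INR (S m)) by (field; lra).
apply Rabs_le_between; lra.
Qed.

(** * Truncated Frullani integrals *)

Lemma continuous_frac_exp (c s x : R) : 0 < x ->
  continuous (fun x => cos (s * x) * (exp (- (c * x)) / x)) x.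
Proof.
intros Hx; apply continuous_derivable; auto_derive; lra.
Qed.

Lemma ex_RInt_frac_exp (c s e M : R) : 0 < e -> e <= M ->
  ex_RInt (fun x => cos (s * x) * (exp (- (c * x)) / x)) e M.
Proof.
intros He HM; apply (ex_RInt_continuous (V := R_CompleteNormedModule)); intros x Hx.
rewrite Rmin_left, Rmax_right in Hx by lra.
apply continuous_frac_exp; lra.
Qed.

(** For [0 < c] this is the integral of [sin (s * t) * exp (- (c * t))] over [t] from [x] to
    infinity; at [x = 0] it is the Laplace transform [s / (c^2 + s^2)]. *)
Definition sin_laplace (c s x : R) : R :=
  exp (- (c * x)) * (c * sin (s * x) + s * cos (s * x)) / (c ^ 2 + s ^ 2).

Lemma is_derive_sin_laplace (c s x : R) : 0 < c ->
  is_derive (sin_laplace c s) x (- (sin (s * x) * exp (- (c * x)))).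
Proof.
intros Hc; assert (H := pow2_ge_0 s).
unfold sin_laplace; auto_derive; [nra|]; field; nra.
Qed.

(** Differentiation under the integral sign: the factor [x] from the chain rule cancels [1 / x],
    leaving the derivative of [sin_laplace c s]. *)
Lemma is_derive_RInt_frac_exp (c e M s : R) : 0 < c -> 0 < e -> e <= M ->
  is_derive (fun s => RInt (fun x => cos (s * x) * (exp (- (c * x)) / x)) e M) s
    (sin_laplace c s M - sin_laplace c s e).
Proof.
intros Hc He HM.
assert (Hd : forall u x, is_derive (fun z => cos (z * x) * (exp (- (c * x)) / x)) u
               (- sin (u * x) * x * (exp (- (c * x)) / x))).
{ intros u x; auto_derive; trivial; unfold Rdiv; ring. }
replace (sin_laplace c s M - sin_laplace c s e) with
  (RInt (fun x => Derive (fun z => cos (z * x) * (exp (- (c * x)) / x)) s) e M).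
- apply is_derive_RInt_param.
  + apply filter_forall; intros u x _; eexists; apply Hd.
  + intros x Hx; rewrite Rmin_left, Rmax_right in Hx by lra.
    (* The factor [v] is left uncancelled so that the equality holds for every [v]; [0 < x] enters
       only in the continuity of the last factor. *)
    apply continuity_2d_pt_ext with
      (fun u v => - sin (u * v) * v * (exp (- (c * v)) / v)).
    { intros u v; symmetry; apply is_derive_unique, Hd. }
    assert (Huv := continuity_2d_pt_mult _ _ s x
                     (continuity_2d_pt_id1 s x) (continuity_2d_pt_id2 s x)).
    apply continuity_2d_pt_mult; [apply continuity_2d_pt_mult|].
    * apply continuity_2d_pt_opp.
      apply (continuity_1d_2d_pt_comp sin (fun u v => u * v)); [|exact Huv].
      apply continuity_sin.
    * apply continuity_2d_pt_id2.
    * apply (continuity_1d_2d_pt_comp (fun v => exp (- (c * v)) / v) (fun _ v => v) s x);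
        [|apply continuity_2d_pt_id2].
      apply continuity_pt_filterlim.
      apply (continuous_derivable (fun v => exp (- (c * v)) / v) x); auto_derive; lra.
  + apply filter_forall; intros u; apply ex_RInt_frac_exp; assumption.
- apply (is_RInt_unique (V := R_CompleteNormedModule)).
  apply (is_RInt_ext (V := R_NormedModule) (fun x => - (sin (s * x) * exp (- (c * x))))).
  { intros x Hx; rewrite Rmin_left, Rmax_right in Hx by lra.
    symmetry; apply is_derive_unique.
    replace (- (sin (s * x) * exp (- (c * x))))
      with (- sin (s * x) * x * (exp (- (c * x)) / x)) by (field; lra).
    apply Hd. }
  apply (is_RInt_derive (V := R_CompleteNormedModule)); intros x _.
  + apply is_derive_sin_laplace, Hc.
  + apply continuous_derivable; auto_derive; trivial.
Qed.

(** The derivative in [x] is at most [1] in absolute value on [[0, e]], which makes the bound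
    uniform in [s]. *)
Lemma sin_laplace_0_near (c s e : R) : 0 < c -> 0 <= e ->
  Rabs (sin_laplace c s e - s / (c ^ 2 + s ^ 2)) <= e.
Proof.
intros Hc He.
destruct (MVT_gen (sin_laplace c s) 0 e (fun x => - (sin (s * x) * exp (- (c * x)))))
  as [x [Hx E]].
- intros x _; apply is_derive_sin_laplace, Hc.
- intros x _; apply derivable_continuous_pt; eexists; apply is_derive_Reals.
  apply is_derive_sin_laplace, Hc.
- rewrite Rmin_left, Rmax_right in Hx by lra.
  replace (s / (c ^ 2 + s ^ 2)) with (sin_laplace c s 0).
  2:{ unfold sin_laplace; rewrite !Rmult_0_r, Ropp_0, exp_0, sin_0, cos_0.
      f_equal; ring. }
  rewrite E, Rabs_mult, Rabs_Ropp, Rabs_mult, Rminus_0_r, (Rabs_right e) by lra.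
  rewrite (Rabs_right (exp _)) by (left; apply exp_pos).
  assert (H1 : Rabs (sin (s * x)) <= 1) by (apply Rabs_le_between, SIN_bound).
  assert (H2 : exp (- (c * x)) <= 1).
  { rewrite <- exp_0; apply exp_monotone; nra. }
  assert (H3 := exp_pos (- (c * x))); assert (H4 := Rabs_pos (sin (s * x))).
  assert (Rabs (sin (s * x)) * exp (- (c * x)) <= 1) by nra.
  nra.
Qed.

Lemma exp_opp_le_inv (x : R) : 0 < x -> exp (- x) <= / x.
Proof.
intros Hx; rewrite exp_Ropp; apply Rinv_le_contravar; [exact Hx|].
generalize (exp_ineq1_le x); lra.
Qed.

(** Combines [(c + Rabs s) / (c^2 + s^2) <= 2 / c] with [exp (- (c * M)) <= / (c * M)]; the first
    removes the dependence on [s]. *)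
Lemma sin_laplace_le (c s M : R) : 0 < c -> 0 < M ->
  Rabs (sin_laplace c s M) <= 2 / (c ^ 2 * M).
Proof.
intros Hc HM; unfold sin_laplace.
assert (Hs := pow2_abs s); assert (Ha := Rabs_pos s).
assert (H0 : 0 < c ^ 2 + s ^ 2) by (generalize (pow2_ge_0 s); nra).
rewrite Rabs_div, Rabs_mult, (Rabs_right (c ^ 2 + s ^ 2)), (Rabs_right (exp _))
  by (try (left; apply exp_pos); lra).
assert (H1 : Rabs (c * sin (s * M) + s * cos (s * M)) <= c + Rabs s).
{ apply Rle_trans with (1 := Rabs_triang _ _).
  rewrite !Rabs_mult, (Rabs_right c) by lra.
  assert (Rabs (sin (s * M)) <= 1) by (apply Rabs_le_between, SIN_bound).
  assert (Rabs (cos (s * M)) <= 1) by (apply Rabs_le_between, COS_bound).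
  nra. }
assert (H2 : (c + Rabs s) / (c ^ 2 + s ^ 2) <= 2 / c).
{ apply (Rmult_le_reg_r (c * (c ^ 2 + s ^ 2))); [nra|].
  field_simplify; [|lra|lra].
  rewrite <- Hs; generalize (pow2_ge_0 (c - Rabs s)); nra. }
assert (H3 : exp (- (c * M)) <= / (c * M)) by (apply exp_opp_le_inv; nra).
replace (2 / (c ^ 2 * M)) with (/ (c * M) * (2 / c)) by (field; lra).
unfold Rdiv at 1; rewrite Rmult_assoc.
apply Rmult_le_compat; [left; apply exp_pos| |exact H3|].
- apply Rmult_le_pos; [apply Rabs_pos|left; apply Rinv_0_lt_compat, H0].
- apply Rle_trans with (2 := H2); apply Rmult_le_compat_r; [|exact H1].
  left; apply Rinv_0_lt_compat, H0.
Qed.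

(* Truncated Frullani integral: as a function of [s] the integral of [cos (s x) exp (- c x) / x]
   has derivative close to [- s / (c^2 + s^2)], uniformly in [s]. *)
Lemma frullani_cos_exp (a b c e M : R) : 0 < c -> 0 < e -> e <= M ->
  Rabs (RInt (fun x => (cos (a * x) - cos (b * x)) * (exp (- (c * x)) / x)) e M
        - (ln (c ^ 2 + b ^ 2) - ln (c ^ 2 + a ^ 2)) / 2)
  <= Rabs (a - b) * (e + 2 / (c ^ 2 * M)).
Proof.
intros Hc He HM.
(* Adding a primitive of [s / (c^2 + s^2)] leaves only the endpoint errors at [e] and [M] in [dphi];
   the mean value theorem then supplies the factor [Rabs (a - b)]. *)
set (phi := fun s => RInt (fun x => cos (s * x) * (exp (- (c * x)) / x)) e M
                     + ln (c ^ 2 + s ^ 2) / 2).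
assert (Hpos : forall s, 0 < c ^ 2 + s ^ 2).
{ intros s; generalize (pow2_ge_0 s); nra. }
set (dphi := fun s => (sin_laplace c s M - sin_laplace c s e) + s / (c ^ 2 + s ^ 2)).
assert (Hphi : forall s, is_derive phi s (dphi s)).
{ intros s; apply (is_derive_plus (V := R_NormedModule)).
  - apply is_derive_RInt_frac_exp; assumption.
  - specialize (Hpos s); auto_derive; [lra|field; lra]. }
destruct (MVT_gen phi b a dphi) as [s [_ E]].
- intros s _; apply Hphi.
- intros s _; apply derivable_continuous_pt; exists (dphi s); apply is_derive_Reals, Hphi.
- replace (RInt _ e M - _) with (phi a - phi b).
  + rewrite E, Rabs_mult, Rmult_comm.
    apply Rmult_le_compat_l; [apply Rabs_pos|].
    assert (H1 := sin_laplace_0_near c s e Hc (Rlt_le _ _ He)).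
    assert (H2 := sin_laplace_le c s M Hc (Rlt_le_trans _ _ _ He HM)).
    apply Rabs_le_between in H1; apply Rabs_le_between in H2.
    unfold dphi; apply Rabs_le_between; lra.
  + unfold phi.
    rewrite (RInt_ext (V := R_CompleteNormedModule)
               (fun x => (cos (a * x) - cos (b * x)) * (exp (- (c * x)) / x))
               (fun x => minus (cos (a * x) * (exp (- (c * x)) / x))
                               (cos (b * x) * (exp (- (c * x)) / x)))).
    2:{ intros x _; unfold minus, plus, opp; simpl; ring. }
    rewrite (RInt_minus (V := R_CompleteNormedModule)) by (apply ex_RInt_frac_exp; assumption).
    unfold minus, plus, opp; simpl; lra.
Qed.

(** * Expansion of [1 / sinh] and its remainder *)

Lemma sinh_ge (x : R) : 0 <= x -> x <= sinh x.
Proof.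
intros Hx.
destruct (mvt_from_0 sinh cosh x is_derive_sinh) as [c [_ [_ E]]].
rewrite sinh_0 in E; generalize (cosh_ge_1 c); nra.
Qed.

Lemma one_sub_cos_le (u : R) : 0 <= 1 - cos u <= u ^ 2.
Proof.
split; [generalize (COS_bound u); lra|].
destruct (mvt_from_0 sin cos (u / 2)) as [c [_ [_ E]]].
{ intros x; apply is_derive_Reals, derivable_pt_lim_sin. }
rewrite sin_0, Rminus_0_r in E.
replace (cos u) with (1 - 2 * sin (u / 2) * sin (u / 2))
  by (rewrite <- cos_2a_sin; f_equal; field).
rewrite E.
assert (Hc : cos c ^ 2 <= 1).
{ generalize (COS_bound c); intros; nra. }
assert (0 <= u ^ 2) by apply pow2_ge_0.
nra.
Qed.

(** Vanishing to second order at [0] compensates the singularity of [1 / (x * sinh (beta * x))]. *)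
Lemma cos_sub_cos_le (a b x : R) :
  Rabs (cos (a * x) - cos (b * x)) <= (a ^ 2 + b ^ 2) * x ^ 2.
Proof.
assert (Ha := one_sub_cos_le (a * x)); assert (Hb := one_sub_cos_le (b * x)).
apply Rabs_le_between; nra.
Qed.

(** What remains of the integrand after [n] terms of the expansion of [1 / sinh]; index [0] gives
    the whole integrand. *)
Definition tail_integrand (a b beta : R) (n : nat) (x : R) : R :=
  (cos (a * x) - cos (b * x)) / x * (exp (- (2 * INR n * beta * x)) / sinh (beta * x)).

Lemma ex_RInt_tail (a b beta e M : R) (n : nat) : 0 < beta -> 0 < e -> e <= M ->
  ex_RInt (tail_integrand a b beta n) e M.
Proof.
intros Hb He HM; apply (ex_RInt_continuous (V := R_CompleteNormedModule)); intros x Hx.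
rewrite Rmin_left, Rmax_right in Hx by lra.
assert (H := sinh_ge (beta * x)).
apply continuous_derivable; unfold tail_integrand; auto_derive.
repeat split; nra.
Qed.

Lemma tail_integrand_le (a b beta x : R) (n : nat) : 0 < beta -> 0 < x ->
  Rabs (tail_integrand a b beta n x) <=
  (a ^ 2 + b ^ 2) / beta * exp (- (2 * INR n * beta * x)).
Proof.
intros Hb Hx; unfold tail_integrand.
assert (Hs : beta * x <= sinh (beta * x)) by (apply sinh_ge; nra).
assert (Hbx : 0 < beta * x) by nra.
assert (He := exp_pos (- (2 * INR n * beta * x))).
unfold Rdiv; rewrite !Rabs_mult, !Rabs_inv, (Rabs_right x), (Rabs_right (exp _)),
  (Rabs_right (sinh _)) by lra.
rewrite (Rmult_comm (exp _)), <- Rmult_assoc.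
apply Rmult_le_compat_r; [lra|].
replace ((a ^ 2 + b ^ 2) * / beta) with ((a ^ 2 + b ^ 2) * x ^ 2 * / x * / (beta * x))
  by (field; lra).
apply Rmult_le_compat.
- apply Rmult_le_pos; [apply Rabs_pos|left; apply Rinv_0_lt_compat, Hx].
- left; apply Rinv_0_lt_compat; lra.
- apply Rmult_le_compat_r; [left; apply Rinv_0_lt_compat, Hx|apply cos_sub_cos_le].
- apply Rinv_le_contravar; assumption.
Qed.

(** Integrating the pointwise bound gives at most [K / (2 * N * beta)], uniformly in [e] and [M];
    the index [S n] ensures a positive decay rate. *)
Lemma RInt_tail_le (a b beta e M : R) (n : nat) : 0 < beta -> 0 < e -> e <= M ->
  Rabs (RInt (tail_integrand a b beta (S n)) e M) <= (a ^ 2 + b ^ 2) / beta ^ 2 / INR (S n).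
Proof.
intros Hb He HM.
assert (HN : 0 < INR (S n)) by (apply lt_0_INR; lia).
set (N := INR (S n)) in *.
set (K := (a ^ 2 + b ^ 2) / beta).
assert (HK : 0 <= K).
{ apply Rdiv_le_0_compat; [|assumption].
  generalize (pow2_ge_0 a) (pow2_ge_0 b); lra. }
set (G := fun x => - (K / (2 * N * beta)) * exp (- (2 * N * beta * x))).
assert (Hk : 0 < 2 * N * beta) by (repeat apply Rmult_lt_0_compat; lra).
assert (HG : is_RInt (fun x => K * exp (- (2 * N * beta * x))) e M (minus (G M) (G e))).
{ apply (is_RInt_derive (V := R_CompleteNormedModule)); intros x _.
  - unfold G; auto_derive; trivial; field; lra.
  - apply continuous_derivable; auto_derive; trivial. }
assert (HT := ex_RInt_tail a b beta e M (S n) Hb He HM).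
apply Rle_trans with (1 := abs_RInt_le _ _ _ HM HT).
apply Rle_trans with (minus (G M) (G e)).
- rewrite <- (is_RInt_unique (V := R_CompleteNormedModule) _ _ _ _ HG).
  apply RInt_le; [exact HM| |eexists; exact HG|].
  + apply (ex_RInt_norm (tail_integrand a b beta (S n))), HT.
  + intros x Hx; apply tail_integrand_le; lra.
- replace ((a ^ 2 + b ^ 2) / beta ^ 2 / N) with (2 * (K / (2 * N * beta)))
    by (unfold K; field; lra).
  assert (0 <= K / (2 * N * beta)) by (apply Rdiv_le_0_compat; assumption).
  assert (H1 := exp_pos (- (2 * N * beta * M))).
  assert (H2 : exp (- (2 * N * beta * e)) <= 1).
  { rewrite <- exp_0; apply exp_monotone; nra. }
  change (minus (G M) (G e)) with (G M - G e); unfold G; nra.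
Qed.

Lemma RInt_tail_S (a b beta e M : R) (n : nat) : 0 < beta -> 0 < e -> e <= M ->
  RInt (tail_integrand a b beta n) e M =
  RInt (tail_integrand a b beta (S n)) e M
  + 2 * RInt (fun x => (cos (a * x) - cos (b * x))
                       * (exp (- (INR (2 * n + 1) * beta * x)) / x)) e M.
Proof.
intros Hb He HM.
set (h := fun x => (cos (a * x) - cos (b * x))
                   * (exp (- (INR (2 * n + 1) * beta * x)) / x)).
assert (Hh : ex_RInt h e M).
{ apply (ex_RInt_continuous (V := R_CompleteNormedModule)); intros x Hx.
  rewrite Rmin_left, Rmax_right in Hx by lra.
  apply continuous_derivable; unfold h; auto_derive; lra. }
apply (is_RInt_unique (V := R_CompleteNormedModule)).
apply (is_RInt_ext (V := R_NormedModule)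
         (fun x => plus (tail_integrand a b beta (S n) x) (scal 2 (h x)))).
- intros x Hx; rewrite Rmin_left, Rmax_right in Hx by lra.
  unfold plus, scal, tail_integrand, h; simpl; unfold mult; simpl.
  assert (Hs : beta * x <= sinh (beta * x)) by (apply sinh_ge; nra).
  assert (Hbx : 0 < beta * x) by nra.
  change (match n with O => 1 | S _ => INR n + 1 end) with (INR (S n)).
  replace (n + (n + 0) + 1)%nat with (2 * n + 1)%nat by lia.
  rewrite S_INR, plus_INR, mult_INR; change (INR 2) with 2; change (INR 1) with 1.
  set (u := 2 * INR n * beta * x).
  replace (- (2 * (INR n + 1) * beta * x)) with (- u + (- (beta * x) + - (beta * x)))
    by (unfold u; ring).
  replace (- ((2 * INR n + 1) * beta * x)) with (- u + - (beta * x)) by (unfold u; ring).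
  rewrite !exp_plus.
  set (v := beta * x) in *.
  assert (Hinv : exp v * exp (- v) = 1) by (rewrite <- exp_plus, Rplus_opp_r; apply exp_0).
  (* This is [1 / sinh v = 2 exp (- v) + exp (- 2 v) / sinh v], one step of the expansion, cleared
     of denominators. *)
  assert (E : 1 = exp (- v) * exp (- v) + 2 * exp (- v) * sinh v).
  { unfold sinh; lra. }
  apply (Rmult_eq_reg_r (x * sinh v)); [|apply Rmult_integral_contrapositive; lra].
  field_simplify; [|lra|lra].
  replace (exp (- v) ^ 2) with (1 - 2 * exp (- v) * sinh v) by (simpl; lra).
  ring.
- apply (is_RInt_plus (V := R_NormedModule)).
  + apply (RInt_correct (V := R_CompleteNormedModule)), ex_RInt_tail; assumption.
  + apply (is_RInt_scal (V := R_NormedModule)).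
    apply (RInt_correct (V := R_CompleteNormedModule)), Hh.
Qed.

(** Telescopes [RInt_tail_S], paying one Frullani error per term; the [2] there cancels the [/ 2] of
    the Frullani value. *)
Lemma RInt_tail_expansion (a b beta e M : R) (n : nat) : 0 < beta -> 0 < e -> e <= M ->
  Rabs (RInt (tail_integrand a b beta 0) e M - RInt (tail_integrand a b beta n) e M
        - (sum_ln_odd (b / beta) n - sum_ln_odd (a / beta) n))
  <= INR n * (2 * Rabs (a - b) * (e + 2 / (beta ^ 2 * M))).
Proof.
intros Hb He HM.
induction n as [|n IH].
- simpl; rewrite !Rminus_diag, Rabs_R0; lra.
- rewrite (RInt_tail_S a b beta e M n Hb He HM) in IH.
  assert (Hc1 : 1 <= INR (2 * n + 1)) by (apply (le_INR 1); lia).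
  set (c := INR (2 * n + 1) * beta) in *.
  assert (Hc : beta <= c) by (unfold c; nra).
  assert (HF := frullani_cos_exp a b c e M (Rlt_le_trans _ _ _ Hb Hc) He HM).
  (* Factoring out [beta^2] rescales the parameters to [s / beta]; the common [2 * ln beta] cancels
     between [b] and [a]. *)
  assert (Hln : forall s, ln (c ^ 2 + s ^ 2) =
            2 * ln beta + ln (INR (2 * n + 1) ^ 2 + (s / beta) ^ 2)).
  { intros s; assert (0 <= (s / beta) ^ 2) by apply pow2_ge_0.
    replace (2 * ln beta) with (ln (beta * beta)) by (rewrite ln_mult; lra).
    rewrite <- ln_mult by nra.
    f_equal; unfold c; field; lra. }
  rewrite !Hln in HF.
  (* Since [beta <= c], the error at [beta] dominates that of every term. *)
  assert (Herr : 2 * (Rabs (a - b) * (e + 2 / (c ^ 2 * M)))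
                 <= 2 * Rabs (a - b) * (e + 2 / (beta ^ 2 * M))).
  { assert (HA := Rabs_pos (a - b)).
    rewrite Rmult_assoc; apply Rmult_le_compat_l; [lra|].
    apply Rmult_le_compat_l; [exact HA|]; apply Rplus_le_compat_l.
    apply Rmult_le_compat_l; [lra|]; apply Rinv_le_contravar;
      [apply Rmult_lt_0_compat; nra|].
    apply Rmult_le_compat_r; [lra|]; apply pow_incr; lra. }
  change (sum_ln_odd (b / beta) (S n))
    with (sum_ln_odd (b / beta) n + ln (INR (2 * n + 1) ^ 2 + (b / beta) ^ 2)).
  change (sum_ln_odd (a / beta) (S n))
    with (sum_ln_odd (a / beta) n + ln (INR (2 * n + 1) ^ 2 + (a / beta) ^ 2)).
  rewrite S_INR, Rmult_plus_distr_r, Rmult_1_l.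
  apply Rabs_le_between in IH; apply Rabs_le_between in HF.
  apply Rabs_le_between; lra.
Qed.

(** * Choice of the truncations and passage to the limit *)

Theorem mainTheorem6 (a b beta : R) (hbeta : 0 < beta) :
  is_RInt_gen
    (fun x : R => (cos (a * x) - cos (b * x)) / sinh (beta * x) * (1 / x))
    (at_right 0) (Rbar_locally p_infty)
    (ln (cosh (b * PI / (2 * beta))) - ln (cosh (a * PI / (2 * beta)))).
Proof.
replace (b * PI / (2 * beta)) with (b / beta * (PI / 2)) by (field; lra).
replace (a * PI / (2 * beta)) with (a / beta * (PI / 2)) by (field; lra).
set (L := ln (cosh (b / beta * (PI / 2))) - ln (cosh (a / beta * (PI / 2)))).
destruct (sum_ln_odd_approx (a / beta) (b / beta)) as [K [HK HS]]; fold L in HS.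
intros P [eps HP].
set (K' := (a ^ 2 + b ^ 2) / beta ^ 2).
assert (HK' : 0 <= K').
{ apply Rdiv_le_0_compat; [|nra].
  generalize (pow2_ge_0 a) (pow2_ge_0 b); lra. }
assert (Heps := cond_pos eps).
(* The number of terms is fixed first, from [eps] alone, so that product and remainder errors total
   less than [eps / 2]; [e] and [M] are constrained afterwards. *)
destruct (nfloor_ex (2 * (K + K') / eps)) as [m [_ Hm]].
{ apply Rdiv_le_0_compat; lra. }
assert (HN : 0 < INR (S m)) by (apply lt_0_INR; lia).
assert (Hsmall : (K + K') / INR (S m) < eps / 2).
{ rewrite <- S_INR in Hm.
  apply (Rmult_lt_reg_r (2 * INR (S m) / eps)); [apply Rdiv_lt_0_compat; lra|].
  replace ((K + K') / INR (S m) * (2 * INR (S m) / eps)) with (2 * (K + K') / eps)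
    by (field; lra).
  replace (eps / 2 * (2 * INR (S m) / eps)) with (INR (S m)) by (field; lra).
  exact Hm. }
set (n := S (S m)).
(* The added [1] keeps [C] positive when [a = b], so that [d] can be defined by division. *)
set (C := INR n * (2 * Rabs (a - b)) + 1).
assert (HC : 0 < C).
{ unfold C; generalize (Rabs_pos (a - b)) (pos_INR n); nra. }
set (d := eps / (4 * C)).
assert (Hd : 0 < d) by (apply Rdiv_lt_0_compat; lra).
(* The first entry ensures [e < d < M], the second [2 / (beta^2 * M) <= d]. *)
set (M0 := Rmax d (2 / (beta ^ 2 * d))).
assert (Hb2 : 0 < beta ^ 2) by nra.
apply (Filter_prod _ _ _ (fun e => 0 < e < d) (fun M => M0 < M)).
- exists (mkposreal d Hd); intros e He Hpos; simpl in He.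
  unfold ball in He; simpl in He; unfold AbsRing_ball, abs, minus, plus, opp in He; simpl in He.
  rewrite Ropp_0, Rplus_0_r, Rabs_right in He by lra; lra.
- exists M0; trivial.
- intros e M [He Hed] HM; simpl.
  assert (HdM : d < M) by (apply Rle_lt_trans with (2 := HM), Rmax_l).
  assert (HM2 : 2 / (beta ^ 2 * M) <= d).
  { assert (H := Rmax_r d (2 / (beta ^ 2 * d))); fold M0 in H.
    apply (Rmult_le_reg_r (M / d)); [apply Rdiv_lt_0_compat; lra|].
    replace (2 / (beta ^ 2 * M) * (M / d)) with (2 / (beta ^ 2 * d)) by (field; lra).
    replace (d * (M / d)) with M by (field; lra); lra. }
  exists (RInt (tail_integrand a b beta 0) e M); split.
  + apply (is_RInt_ext (V := R_NormedModule) (tail_integrand a b beta 0)).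
    * intros x Hx; rewrite Rmin_left, Rmax_right in Hx by lra.
      assert (Hs := sinh_ge (beta * x)).
      unfold tail_integrand; simpl; rewrite Rmult_0_r, !Rmult_0_l, Ropp_0, exp_0.
      field; split; nra.
    * apply (RInt_correct (V := R_CompleteNormedModule)), ex_RInt_tail; lra.
  + apply HP; unfold ball; simpl; unfold AbsRing_ball, abs, minus, plus, opp; simpl.
    assert (H1 : e <= M) by lra.
    assert (HT := RInt_tail_le a b beta e M (S m) hbeta He H1); fold n K' in HT.
    assert (HX := RInt_tail_expansion a b beta e M n hbeta He H1).
    specialize (HS m); fold n in HS.
    (* The remainder has index [n = S (S m)] but the product error has denominator [INR (S m)]; this
       aligns the two. *)
    assert (HT' : K' / INR n <= K' / INR (S m)).
    { apply Rmult_le_compat_l; [exact HK'|]; apply Rinv_le_contravar; [exact HN|].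
      apply le_INR; unfold n; lia. }
    assert (HX' : INR n * (2 * Rabs (a - b) * (e + 2 / (beta ^ 2 * M))) <= eps / 2).
    { rewrite <- Rmult_assoc.
      replace (eps / 2) with (C * (2 * d)) by (unfold d; field; lra).
      apply Rmult_le_compat; [| |unfold C; lra|lra].
      - generalize (Rabs_pos (a - b)) (pos_INR n); nra.
      - assert (0 < 2 / (beta ^ 2 * M)) by (apply Rdiv_lt_0_compat; nra); lra. }
    replace ((K + K') / INR (S m)) with (K / INR (S m) + K' / INR (S m)) in Hsmall
      by (field; lra).
    apply Rabs_le_between in HT; apply Rabs_le_between in HX; apply Rabs_le_between in HS.
    apply Rabs_lt_between; lra.
Qed.
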